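(* Let $N=[n]$ and let $(N\cup\{i\}, G, f^{\leq 0})$ be a social network under the all-but-$\kappa$ protocol with $\kappa=0$ (unanimity dynamics). There exists a Consistent Hypothesis Finder that, for any labelling sample of size $m$ (together with the oracle predictions for agent $i$), finds a feasible influencer set $F\subseteq N$ in $\mathcal{O}(m\,n^2)$ time.
   Context: $N=[n]=\{1,\dots,n\}$ is a finite set of agents and $i$ is an additional distinguished target agent. $G$ is a directed graph on $N\cup\{i\}$; $G_i=\{j\in N: j\to i \text{ in } G\}$ is the (unknown) influencer set of $i$. A network labelling is a function $\ell:N\to L$ with $L=\{\phi,\neg\phi\}$; $\ell(j)=\phi$ means that $j$ agrees with agent $i$, and $\ell(j)=\neg\phi$ that $j$ disagrees with agent $i$. For an integer $\kappa\ge 0$, the all-but-$\kappa$ protocol is the boolean sentence, for $\ell\in L^N$ and $F\subseteq N$, $$f^{\leq\kappa}(\ell,F):\quad \sum_{j\in F}\mathbf 1(\ell(j)=\phi)\leq\kappa,$$ which is True if agent $i$ (with influencers $F$) changes opinion and False otherwise. A labelling sample of size $m$ is a sequence $\ell_1,\dots,\ell_m\in L^N$ together with the oracle predictions (truth values) $f(\ell_k,G_i)$, $k=1,\dots,m$. A set $F\subseteq N$ is a feasible influencer set for the sample if $f(\ell_k,F)=f(\ell_k,G_i)$ for all $k=1,\dots,m$. A Consistent Hypothesis Finder (CHF) is an algorithm that, for every $m>0$, every $G_i\subseteq N$ and every labelling sample of size $m$ generated with $G_i$ (the algorithm sees the labellings and predictions, not $G_i$), outputs a feasible influencer set $F\subseteq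 N$ for the sample. *)

(* Defs.v *)
From mathcomp Require Import all_boot.

Set Implicit Arguments.
Unset Strict Implicit.
Unset Printing Implicit Defensive.

(* The agents N = [n] are the elements of 'I_n; in the vertex type
   [option 'I_n], [Some j] is the agent j of N and [None] is the target
   agent i. *)
Definition network (n : nat) := rel (option 'I_n).

Definition influencers n (G : network n) : {set 'I_n} :=
  [set j | G (Some j) None].

(* L = {phi, ~phi} is bool, with phi (agreement with i) = true. *)
Definition labelling (n : nat) := {ffun 'I_n -> bool}.

Definition all_but (kappa n : nat) (l : labelling n) (F : {set 'I_n}) : bool :=
  \sum_(j in F) (l j == true) <= kappa.

Definition feasible kappa n m (ls : m.-tuple (labelling n))
    (Gi F : {set 'I_n}) : Prop :=
  forall k : 'I_m, all_but kappa (tnth ls k) F = all_but kappa (tnth ls k) Gi.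

(* Algorithms are programs of the random access machine of Cook and Reckhow
   (Time bounded random access machines, 1973), over natural numbers with
   truncated subtraction, at unit cost per instruction. The machine has
   infinitely many cells, initially 0, a read-only input tape read
   sequentially and a write-only output tape; it halts when the program
   counter leaves the program. Reading past the end of the input gives 0. *)

Inductive instr :=
  | Const of nat & nat
  | Plus of nat & nat & nat
  | Minus of nat & nat & nat
  | Fetch of nat & nat
  | Store of nat & nat
  | Jpos of nat & nat
  | Read of nat
  | Print of nat.

Definition program := seq instr.

Record config := Config {
  pc : nat;
  mem : nat -> nat;
  inp : seq nat;
  out : seq nat }.

Definition upd (X : nat -> nat) (a v : nat) : nat -> nat :=
  fun b => if b == a then v else X b.

Definition exec (i : instr) (s : config) : config :=
  let: Config p X w o := s in
  match i with
  | Const a c => Config p.+1 (upd X a c) w o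
  | Plus a b c => Config p.+1 (upd X a (X b + X c)) w o
  | Minus a b c => Config p.+1 (upd X a (X b - X c)) w o
  | Fetch a b => Config p.+1 (upd X a (X (X b))) w o
  | Store a b => Config p.+1 (upd X (X a) (X b)) w o
  | Jpos q a => Config (if 0 < X a then q else p.+1) X w o
  | Read a => Config p.+1 (upd X a (head 0 w)) (behead w) o
  | Print a => Config p.+1 X w (rcons o (X a))
  end.

Definition step (P : program) (s : config) : config :=
  if onth P (pc s) is Some i then exec i s else s.

Definition init (w : seq nat) : config := Config 0 (fun=> 0) w [::].

Definition halted (P : program) (s : config) : bool := size P <= pc s.

(* On input w, P halts after at most t instructions with output o; halted
   configurations are fixed points of [step]. *)
Definition outputs_within (P : program) (w : seq nat) (t : nat) (o : seq nat)
    : Prop :=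
  let s := iter t (step P) (init w) in halted P s /\ out s = o.

(* The input tape holds n, m and, for each k, the n label bits of l_k
   followed by the oracle prediction f(l_k, G_i); G_i enters only through
   these predictions. *)
Definition encode_sample kappa n m (ls : m.-tuple (labelling n))
    (Gi : {set 'I_n}) : seq nat :=
  n :: m :: flatten
    [seq rcons [seq nat_of_bool (l j) | j <- enum 'I_n]
               (nat_of_bool (all_but kappa l Gi)) | l : labelling n <- ls].

(* A subset of N is output as its n membership bits. *)
Definition encode_set n (F : {set 'I_n}) : seq nat :=
  [seq nat_of_bool (j \in F) | j <- enum 'I_n].

Definition CHF (kappa : nat) (P : program) : Prop :=
  forall (n m : nat) (Gi : {set 'I_n}) (ls : m.-tuple (labelling n)),
    0 < m ->
    exists (t : nat) (F : {set 'I_n}),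
      outputs_within P (encode_sample kappa ls Gi) t (encode_set F) /\
      feasible kappa ls Gi F.

(* Main.v *)
(* Veto every agent that agrees with i in some labelling whose prediction is
   True, and let F be the unvetoed agents. No influencer is ever vetoed, so
   F contains G_i: on a False prediction F inherits an agreeing member from
   G_i, and on a True prediction no member of F agrees. The program computes F
   in one pass over the input, in O(n) instructions per labelling. *)

Require Import Defs.
From mathcomp Require Import all_boot zify.

Set Implicit Arguments.
Unset Strict Implicit.
Unset Printing Implicit Defensive.

(** * Runs of an arbitrary program *)

Section Machine.
Variable P : program.
Implicit Types (X : nat -> nat) (w o : seq nat).

Lemma run_exec t p X w o i : onth P p = Some i ->
  iter t.+1 (step P) (Config p X w o) = iter t (step P) (exec i (Config p X w o)).
Proof. by move=> Pp; rewrite iterSr {2}/step Pp. Qed.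

Lemma run_jump t p X w o q a : onth P p = Some (Jpos q a) -> 0 < X a ->
  iter t.+1 (step P) (Config p X w o) = iter t (step P) (Config q X w o).
Proof. by move=> Pp Xa; rewrite (run_exec _ _ _ _ Pp) /= Xa. Qed.

Lemma run_fall t p X w o q a : onth P p = Some (Jpos q a) -> X a = 0 ->
  iter t.+1 (step P) (Config p X w o) = iter t (step P) (Config p.+1 X w o).
Proof. by move=> Pp Xa; rewrite (run_exec _ _ _ _ Pp) /= Xa. Qed.

Lemma run_halted t s : halted P s -> iter t (step P) s = s.
Proof.
move=> halt; elim: t => //= t ->.
by rewrite /step; rewrite onth_default.
Qed.

(** Halted configurations are fixed by [step], so an exact running time may be rounded up to any
    larger bound. *)
Lemma outputs_within_leq t u w o :
  t <= u -> outputs_within P w t o -> outputs_within P w u o.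
Proof.
move=> /subnK <- [halt <-]; rewrite /outputs_within iterD.
by rewrite run_halted.
Qed.

End Machine.

(* Cell 0 holds n, 1 the number of rows left, 2 the constant 1, 3 the bound
   9 + n of the pointer kept in cell 4, and 6 is 1 when the prediction of the
   last row was False. Agent a owns cell 9 + a, its number of vetoes, and cell
   9 + n + a, its label in the last row. As a prediction follows its labels,
   the vetoes of a row are added to 9 + a only during the next row, or when
   printing. *)
Definition vetoless : program :=
  [:: Read 0; Read 1; Const 2 1; Const 3 9; Plus 3 3 0;
      Const 4 9;
      Minus 7 3 4; Jpos 9 7; Jpos 19 2;
      Plus 5 4 0; Fetch 7 5; Minus 7 7 6; Fetch 8 4; Plus 8 8 7; Store 4 8;
      Read 7; Store 5 7; Plus 4 4 2; Jpos 6 2;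
      Read 7; Minus 6 2 7; Minus 1 1 2; Jpos 5 1;
      Const 4 9;
      Minus 7 3 4; Jpos 27 7; Jpos 36 2;
      Plus 5 4 0; Fetch 7 5; Minus 7 7 6; Fetch 8 4; Plus 8 8 7; Minus 8 2 8;
      Print 8; Plus 4 4 2; Jpos 24 2].

(** * Symbolic execution of [vetoless] *)

Notation run t s := (iter t (step vetoless) s).

Definition regs (X : nat -> nat) (n : nat) := [/\ X 0 = n, X 2 = 1 & X 3 = 9 + n].

(* The truncated difference is the pending veto of the last row. *)
Definition vetoes (X : nat -> nat) n a := X (9 + a) + (X (9 + n + a) - X 6).

Lemma updE X a v b : upd X a v b = if b == a then v else X b.
Proof. by []. Qed.

Arguments upd : simpl never.

(** Reads through nested updates are resolved by letting [lia] decide whether two addresses differ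
    or coincide. *)
Ltac simpl_mem := repeat (rewrite updE ?eqxx || match goal with
  |- context [if ?b == ?a then _ else _] =>
    first [replace (b == a) with false by lia | replace (b == a) with true by lia]
  end); cbn match.
Ltac exec_instr := (erewrite run_exec; last reflexivity); rewrite [exec _ _]/=; simpl_mem.

(** One turn of the reading loop: the pending veto of agent [i] is settled just before its old label
    is overwritten. *)
Lemma read_label n X x w o i : regs X n -> X 4 = 9 + i -> i < n ->
  exists X', [/\ run 12 (Config 6 X (x :: w) o) = Config 6 X' w o,
    regs X' n, X' 1 = X 1, X' 6 = X 6 & X' 4 = 9 + i.+1] /\
    [/\ X' (9 + i) = vetoes X n i, X' (9 + n + i) = x &
    forall a, a < n -> a != i ->
      X' (9 + a) = X (9 + a) /\ X' (9 + n + a) = X (9 + n + a)].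
Proof.
move=> [X0 X2 X3] X4 ltin.
exec_instr; rewrite X3 X4.
rewrite (@run_jump _ _ _ _ _ _ 9 7) //; last by simpl_mem; lia.
exec_instr; rewrite X4 X0; do 3 exec_instr; rewrite X4.
do 2 exec_instr; rewrite X4; do 3 exec_instr; rewrite X4 X2.
rewrite (@run_jump _ _ _ _ _ _ 6 2) //; last by simpl_mem; rewrite X2.
rewrite [run 0 _]/=.
eexists; split; first split; first reflexivity.
- by split; simpl_mem.
- by simpl_mem.
- by simpl_mem.
- by simpl_mem; lia.
- rewrite /vetoes; split; simpl_mem=> //; first by rewrite addnAC.
  by move=> a ltan nai; split; simpl_mem.
Qed.

(** Loop invariant: agents below [i] have total [S] settled and new label [L] stored, while the
    others still split [S] between the veto cell and the pending label. The 3 extra steps leave the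
    loop. *)
Lemma read_labels n (L S : nat -> nat) j w o : forall i X, i + j = n ->
  regs X n -> X 4 = 9 + i ->
  (forall a, a < i -> X (9 + a) = S a /\ X (9 + n + a) = L a) ->
  (forall a, i <= a < n -> vetoes X n a = S a) ->
  exists X', [/\
    run (12 * j + 3) (Config 6 X (map L (iota i j) ++ w) o) = Config 19 X' w o,
    regs X' n, X' 1 = X 1 &
    forall a, a < n -> X' (9 + a) = S a /\ X' (9 + n + a) = L a].
Proof.
elim: j => [|j IHj] i X ijn RX X4 Xlt Xge.
  have [X0 X2 X3] := RX.
  rewrite muln0 add0n [map _ _ ++ _]/=.
  exec_instr; rewrite X3 X4.
  rewrite (@run_fall _ _ _ _ _ _ 9 7) //; last by simpl_mem; lia.
  rewrite (@run_jump _ _ _ _ _ _ 19 2) //; last by simpl_mem; lia.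
  eexists; split; first reflexivity.
  - by split; simpl_mem.
  - by simpl_mem.
  - by move=> a ltan; simpl_mem; apply: Xlt; lia.
have ltin : i < n by lia.
have [X' [[E RX' X'1 X'6 X'4] [X'b X'r X'o]]] :=
  read_label (L i) (map L (iota i.+1 j) ++ w) o RX X4 ltin.
have [|a ltai|a /andP[ltia ltan]|X'' [E' RX'' X''1 X''S]] := IHj i.+1 X' _ RX' X'4.
- by lia.
- have [->|nai] := eqVneq a i; first by rewrite X'b X'r Xge //; lia.
  have [|->->] := X'o a _ nai; first by lia.
  by apply: Xlt; lia.
- have [|E1 E2] := X'o a ltan; first by lia.
  by rewrite /vetoes E1 E2 X'6 -Xge //; lia.
exists X''; split=> //; last by rewrite X''1.
by rewrite mulnS -addnA addnC iterD [map _ _ ++ _]/= E E'.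
Qed.

(** The sweep settles the old totals under the old flag; cell 6 then becomes [1 - b], which makes
    the new row the pending one. *)
Lemma read_row n m r b X w o : size r = n -> regs X n -> X 1 = m.+1 ->
  exists X', [/\
    run (12 * n + 8) (Config 5 X (rcons r b ++ w) o) =
      Config (if 0 < m then 5 else 23) X' w o,
    regs X' n, X' 1 = m &
    forall a, a < n -> vetoes X' n a = vetoes X n a + (nth 0 r a - (1 - b))].
Proof.
move=> sr RX X1; have [X0 X2 X3] := RX.
pose Y := upd X 4 9.
have RY : regs Y n by split; rewrite /Y; simpl_mem.
have [||a ltan||X' [E [X'0 X'2 X'3] X'1 X'S]] :=
  @read_labels n (nth 0 r) (vetoes X n) n (b :: w) o 0 Y _ RY.
- by [].
- by rewrite /Y; simpl_mem.
- by [].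
- by rewrite /vetoes /Y; simpl_mem.
(* [iterD] runs the last summand first: pointer reset, sweep, then four instructions for the
   prediction and the row counter. *)
have -> : 12 * n + 8 = 4 + (12 * n + 3) + 1 by lia.
rewrite iterD; exec_instr; rewrite [run 0 _]/= iterD.
have -> : rcons r b ++ w = mkseq (nth 0 r) n ++ b :: w.
  by rewrite -sr mkseq_nth cat_rcons.
rewrite E.
do 2 exec_instr; rewrite X'2; exec_instr; rewrite X'2 X'1 /Y; simpl_mem; rewrite X1.
eexists; split.
- rewrite (run_exec _ _ _ _ (i := Jpos 5 1)) // [exec _ _]/=; simpl_mem.
  by rewrite subn1 /=; reflexivity.
- by split; simpl_mem.
- by simpl_mem.
- by move=> a ltan; rewrite {1}/vetoes; simpl_mem; have [-> ->] := X'S a ltan.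
Qed.

(** The row counter is tested only after a row has been read, hence the nonempty [rows]. *)
Lemma read_rows n (rows : seq (seq nat * nat)) o : forall X,
  0 < size rows -> all (fun p => size p.1 == n) rows ->
  regs X n -> X 1 = size rows ->
  exists X', [/\
    run (size rows * (12 * n + 8))
      (Config 5 X (flatten [seq rcons p.1 p.2 | p <- rows]) o) =
      Config 23 X' [::] o,
    regs X' n &
    forall a, a < n -> vetoes X' n a =
      vetoes X n a + \sum_(p <- rows) (nth 0 p.1 a - (1 - p.2))].
Proof.
elim: rows => // -[r b] rows IH X _ /andP[/eqP/= sr srs] RX X1.
have [X' [E RX' X'1 X'S]] :=
  read_row b (flatten [seq rcons p.1 p.2 | p <- rows]) o sr RX X1.
rewrite mulSn addnC iterD E.
case: (posnP (size rows)) => [/size0nil rows0 | rows_gt0].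
  rewrite rows0 /=; exists X'; split=> // a ltan.
  by rewrite X'S // big_seq1.
have [X'' [E' RX'' X''S]] := IH X' rows_gt0 srs RX' X'1.
by exists X''; split=> // a ltan; rewrite X''S // X'S // big_cons addnA.
Qed.

(** The last row is still pending, so its vetoes are added on the fly; truncated subtraction from 1
    then tests the total for zero. *)
Lemma print_set n j w : forall i X o, i + j = n -> regs X n -> X 4 = 9 + i ->
  exists X', run (11 * j + 3) (Config 24 X w o) =
    Config 36 X' w (o ++ [seq 1 - vetoes X n a | a <- iota i j]).
Proof.
elim: j => [|j IHj] i X o ijn [X0 X2 X3] X4.
  rewrite muln0 add0n cats0.
  exec_instr; rewrite X3 X4.
  rewrite (@run_fall _ _ _ _ _ _ 27 7) //; last by simpl_mem; lia.
  rewrite (@run_jump _ _ _ _ _ _ 36 2) //; last by simpl_mem; lia.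
  by eexists.
rewrite mulnS -addnA addnC iterD.
exec_instr; rewrite X3 X4.
rewrite (@run_jump _ _ _ _ _ _ 27 7) //; last by simpl_mem; lia.
exec_instr; rewrite X4 X0; do 3 exec_instr; rewrite X4.
do 2 exec_instr; rewrite X2; do 2 exec_instr; rewrite X4 X2.
rewrite (@run_jump _ _ _ _ _ _ 24 2) //; last by simpl_mem; rewrite X2.
rewrite [run 0 _]/=.
set Y := upd _ 4 _.
set v := 1 - _.
have [|||X' ->] := IHj i.+1 Y (rcons o v).
- by lia.
- by rewrite /Y; split; simpl_mem.
- by rewrite /Y; simpl_mem; lia.
by exists X'; rewrite cat_rcons /v addnAC.
Qed.

Lemma vetoless_run (n : nat) (rows : seq (seq nat * nat)) :
  0 < size rows -> all (fun p => size p.1 == n) rows ->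
  outputs_within vetoless
    (n :: size rows :: flatten [seq rcons p.1 p.2 | p <- rows])
    (9 + 11 * n + size rows * (12 * n + 8))
    (mkseq (fun a => 1 - \sum_(p <- rows) (nth 0 p.1 a - (1 - p.2))) n).
Proof.
move=> rows_gt0 srs; set w := flatten _.
have -> : 9 + 11 * n + size rows * (12 * n + 8)
  = 11 * n + 3 + (1 + (size rows * (12 * n + 8) + 5)) by lia.
rewrite /outputs_within /init; set t := 11 * n + 3; set u := _ * _.
rewrite (iterD t (1 + (u + 5))) (iterD 1 (u + 5)) (iterD u 5).
set X := fun=> 0; do 4 exec_instr; exec_instr.
rewrite [run 0 _]/=.
set Y := upd _ 3 _.
have RY : regs Y n by rewrite /Y; split; simpl_mem.
have Y1 : Y 1 = size rows by rewrite /Y; simpl_mem.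
have [X' [-> [X0 X2 X3] X'S]] := read_rows [::] rows_gt0 srs RY Y1.
exec_instr; rewrite [run 0 _]/=; set Z := upd _ 4 9.
have [|||X'' ->] := @print_set n n [::] 0 Z [::].
- by [].
- by rewrite /Z; split; simpl_mem.
- by rewrite /Z; simpl_mem.
split=> //; rewrite [out _]/= /mkseq; apply/eq_in_map => a.
rewrite mem_iota => /andP[_ ltan].
(* [Z] differs from [X'] only in the pointer cell, and the totals in [Y] compute to 0 since memory
   starts at zero. *)
by rewrite -[vetoes Z n a]/(vetoes X' n a) X'S.
Qed.

(** * Feasibility of the unvetoed set and its computation *)

Definition unvetoed n m (ls : m.-tuple (labelling n)) (Gi : {set 'I_n}) :=
  [set j | all (fun l : labelling n => all_but 0 l Gi ==> ~~ l j) ls].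

Lemma all_but0P n (l : labelling n) (F : {set 'I_n}) :
  reflect {in F, forall j, ~~ l j} (all_but 0 l F).
Proof.
rewrite /all_but leqn0 sum_nat_eq0; apply: (iffP forall_inP) => lF j /lF.
  by rewrite eqb0 eqb_id.
by rewrite eqb0 eqb_id.
Qed.

Lemma unvetoed_feasible n m (ls : m.-tuple (labelling n)) Gi :
  feasible 0 ls Gi (unvetoed ls Gi).
Proof.
move=> k; apply/all_but0P/idP => [lF | lG j].
  (* An influencer is never vetoed, since a True prediction means that all influencers disagree. *)
  apply/all_but0P => j jG; apply: lF; rewrite inE; apply/allP => l _.
  by apply/implyP => /all_but0P; apply.
(* The labelling [tnth ls k] has a True prediction, so it vetoes all agents agreeing in it. *)
by rewrite inE => /allP/(_ _ (mem_tnth k ls)); rewrite lG.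
Qed.

Lemma vetoless_outputs n m (ls : m.-tuple (labelling n)) Gi : 0 < m ->
  outputs_within vetoless (encode_sample 0 ls Gi)
    (9 + 11 * n + m * (12 * n + 8)) (encode_set (unvetoed ls Gi)).
Proof.
move=> m_gt0.
pose row (l : labelling n) :=
  ([seq nat_of_bool (l j) | j <- enum 'I_n], nat_of_bool (all_but 0 l Gi)).
have srow : size (map row ls) = m by rewrite size_map size_tuple.
have := @vetoless_run n (map row ls); rewrite srow => /(_ m_gt0).
have -> : all (fun p => size p.1 == n) (map row ls).
  by apply/allP => _ /mapP[l _ ->]; rewrite size_map size_enum_ord.
move=> /(_ isT); rewrite -map_comp /encode_sample.
suff -> : encode_set (unvetoed ls Gi) =
  mkseq (fun a => 1 - \sum_(p <- map row ls) (nth 0 p.1 a - (1 - p.2))) n by [].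
rewrite /mkseq -val_enum_ord -map_comp; apply: eq_map => j /=.
rewrite big_map inE.
(* On bits, [x - (1 - y)] is the conjunction of [x] and [y], so the sum counts the labellings that
   veto [j]. *)
have -> : \sum_(l <- ls) (nth 0 (row l).1 j - (1 - (row l).2)) =
  count (fun l : labelling n => all_but 0 l Gi && l j) ls.
  rewrite -sum1_count [RHS]big_mkcond; apply: eq_bigr => l _ /=.
  rewrite (nth_map j) ?size_enum_ord // nth_ord_enum.
  by case: (all_but 0 l Gi); case: (l j).
rewrite (eq_all (a2 := predC (fun l : labelling n => all_but 0 l Gi && l j))).
  by rewrite all_predC has_count; case: (count _ _).
by move=> l /=; rewrite negb_and implybE.
Qed.

Theorem proposition2 :
  exists P : program,
    CHF 0 P /\
    exists C : nat,
      forall (n m : nat) (G : network n) (ls : m.-tuple (labelling n)),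
        0 < n -> 0 < m ->
        exists F : {set 'I_n},
          outputs_within P (encode_sample 0 ls (influencers G))
            (C * (m * n ^ 2)) (encode_set F) /\
          feasible 0 ls (influencers G) F.
Proof.
exists vetoless; split=> [n m Gi ls m_gt0|].
  exists (9 + 11 * n + m * (12 * n + 8)), (unvetoed ls Gi).
  by split; [apply: vetoless_outputs | apply: unvetoed_feasible].
(* 40 = 9 + 11 + 12 + 8: each of 1, [n], [m * n] and [m] is at most [m * n ^ 2] for positive [n] and
   [m]. *)
exists 40 => n m G ls n_gt0 m_gt0; exists (unvetoed ls (influencers G)).
split; last exact: unvetoed_feasible.
apply: outputs_within_leq (vetoless_outputs _ _ m_gt0).
have : n <= m * n by rewrite leq_pmull.
have : m <= m * n by rewrite leq_pmulr.
have : m * n <= m * n ^ 2 by rewrite leq_mul2l leq_pmulr // orbT.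
lia.
Qed.
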